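(* Let $\mathbf{B}$ be a pointed category with binary coproducts and kernels of split epimorphisms. If the canonical adjunction $T\dashv S$, $$T:\mathbf{B}\times\mathbf{B}\to Pt(\mathbf{B}),\quad T(X,B)=(X\sqcup B,[0\ 1],\iota_2,B),\qquad S:Pt(\mathbf{B})\to\mathbf{B}\times\mathbf{B},\quad S(A,\alpha,\beta,B)=(K[\alpha],B),$$ is an equivalence of categories, then there are equivalences of categories $$RG(\mathbf{B})\sim Mor(\mathbf{B})\qquad\text{and}\qquad PC(\mathbf{B})\sim 2\text{-}Chains(\mathbf{B}).$$
   Context: A category is pointed if it is enriched in pointed sets: for every pair $X,Y$ of objects there is a specified morphism $0_{X,Y}:X\to Y$ with $0_{Z,W}f=0_{Y,W}$ and $f0_{X,Y}=0_{X,Z}$ for every $f:Y\to Z$. No zero object is assumed. $K[\alpha]$ is the (chosen) kernel object of $\alpha$; a kernel of $\alpha$ is a morphism $k$ universal with $\alpha k=0$. $\iota_1,\iota_2$ are coproduct injections and $[f\ g]$ is the morphism out of a coproduct with components $f,g$. $Pt(\mathbf{B})$: objects $(A,\alpha,\beta,B)$ with $\alpha:A\to B$, $\beta:B\to A$, $\alpha\beta=1_B$; morphisms are pairs $(f_1:A\to A',f_0:B\to B')$ with $\alpha'f_1=f_0\alpha$, $f_1\beta=\beta'f_0$. $RG(\mathbf{B})$ (internal reflexive graphs): objects are diagrams $d,c:C_1\to C_0$, $e:C_0\to C_1$ with $de=1=ce$; morphisms are pairs $(f_1,f_0)$ commuting with $d,c,e$. $PC(\mathbf{B})$ (internal precategories):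 objects are diagrams consisting of $\pi_1,\pi_2,m:C_2\to C_1$, $e_1,e_2:C_1\to C_2$, $d,c:C_1\to C_0$, $e:C_0\to C_1$ such that (i) the square with horizontal split epimorphisms $(\pi_2,e_2)$ from $C_2$ to $C_1$ and $(d,e)$ from $C_1$ to $C_0$, and vertical split epimorphisms $(\pi_1,e_1)$ from $C_2$ to $C_1$ and $(c,e)$ from $C_1$ to $C_0$, is a split epimorphism in the category of split epimorphisms, i.e. $\pi_2e_2=1$, $\pi_1e_1=1$, $de=1=ce$, $d\pi_1=c\pi_2$, $\pi_1e_2=ec$, $\pi_2e_1=ed$, $e_1e=e_2e$; (ii) $dm=d\pi_2$, $cm=c\pi_1$; (iii) $me_1=1_{C_1}=me_2$. Morphisms are triples of morphisms of $\mathbf{B}$ commuting with all the structure. $Mor(\mathbf{B})$ is the category of morphisms of $\mathbf{B}$ (with commutative squares as morphisms). $2\text{-}Chains(\mathbf{B})$ has as objects sequences $Z\xrightarrow{t}X\xrightarrow{h}B$ in $\mathbf{B}$ with $ht=0$, and as morphisms the triples of morphisms making the evident squares commute. *)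

(* Defs.v *)
(* Plain Rocq with the standard library.  Morphisms are compared with Leibniz
   equality, so proof irrelevance is used to compare morphisms that carry
   proofs of commutativity. *)
From Stdlib Require Import ssreflect ssrfun ProofIrrelevance.

Set Implicit Arguments.
Unset Strict Implicit.
Unset Printing Implicit Defensive.

Declare Scope cat_scope.
Delimit Scope cat_scope with cat.
Local Open Scope cat_scope.

Record category := Category {
  ob :> Type;
  hom : ob -> ob -> Type;
  idm : forall X, hom X X;
  comp : forall X Y Z, hom Y Z -> hom X Y -> hom X Z;
  comp1m : forall X Y (f : hom X Y), comp (idm Y) f = f;
  compm1 : forall X Y (f : hom X Y), comp f (idm X) = f;
  compA : forall X Y Z W (h : hom Z W) (g : hom Y Z) (f : hom X Y),
    comp h (comp g f) = comp (comp h g) f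
}.

Arguments hom {c} X Y.
Arguments idm {c} X.
Arguments comp {c X Y Z} g f.
Arguments comp1m {c X Y} f.
Arguments compm1 {c X Y} f.
Arguments compA {c X Y Z W} h g f.

Notation "g ∘ f" := (comp g f) (at level 40, left associativity) : cat_scope.

Definition is_iso (C : category) (X Y : C) (f : hom X Y) : Prop :=
  exists g : hom Y X, g ∘ f = idm X /\ f ∘ g = idm Y.

Record functor (C D : category) := Functor {
  fob :> C -> D;
  fmap : forall X Y, hom X Y -> hom (fob X) (fob Y);
  fmap1 : forall X, fmap (idm X) = idm (fob X);
  fmapM : forall X Y Z (g : hom Y Z) (f : hom X Y),
    fmap (g ∘ f) = fmap g ∘ fmap f
}.

Arguments fmap {C D} F {X Y} _ : rename.

Definition id_functor (C : category) : functor C C.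
Proof.
by refine (@Functor C C (fun X => X) (fun X Y f => f) _ _).
Defined.

Definition comp_functor (C D E : category) (G : functor D E) (F : functor C D) :
  functor C E.
Proof.
refine (@Functor C E (fun X => G (F X)) (fun X Y f => fmap G (fmap F f)) _ _).
- by move=> X; rewrite !fmap1.
- by move=> X Y Z g f; rewrite !fmapM.
Defined.

Record nattrans (C D : category) (F G : functor C D) := Nattrans {
  component :> forall X, hom (F X) (G X);
  naturality : forall X Y (f : hom X Y),
    component Y ∘ fmap F f = fmap G f ∘ component X
}.

Definition is_natiso (C D : category) (F G : functor C D) (t : nattrans F G) :
  Prop := forall X, is_iso (t X).

Definition naturally_isomorphic (C D : category) (F G : functor C D) : Prop :=
  exists t : nattrans F G, is_natiso t.

Definition equivalent_categories (C D : category) : Prop :=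
  exists (F : functor C D) (G : functor D C),
    naturally_isomorphic (comp_functor G F) (id_functor C) /\
    naturally_isomorphic (comp_functor F G) (id_functor D).

Record adjunction (C D : category) (L : functor C D) (R : functor D C) :=
  Adjunction {
  adj_unit : nattrans (id_functor C) (comp_functor R L);
  adj_counit : nattrans (comp_functor L R) (id_functor D);
  triangleL : forall X, adj_counit (L X) ∘ fmap L (adj_unit X) = idm (L X);
  triangleR : forall Y, fmap R (adj_counit Y) ∘ adj_unit (R Y) = idm (R Y)
}.

Definition adjunction_is_equivalence (C D : category) (L : functor C D)
    (R : functor D C) (A : adjunction L R) : Prop :=
  is_natiso (adj_unit A) /\ is_natiso (adj_counit A).

Definition prod_category (C D : category) : category.
Proof.
refine (@Category (C * D)%type
  (fun X Y => (hom X.1 Y.1 * hom X.2 Y.2)%type)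
  (fun X => (idm X.1, idm X.2))
  (fun X Y Z g f => (g.1 ∘ f.1, g.2 ∘ f.2)) _ _ _).
- by move=> X Y [f g] /=; rewrite !comp1m.
- by move=> X Y [f g] /=; rewrite !compm1.
- by move=> X Y Z W [f1 f2] [g1 g2] [h1 h2] /=; rewrite !compA.
Defined.

Record pointed (C : category) := Pointed {
  zerom : forall X Y : C, hom X Y;
  zerom_comp : forall (X Y Z : C) (f : hom X Y), zerom Y Z ∘ f = zerom X Z;
  comp_zerom : forall (X Y Z : C) (f : hom Y Z), f ∘ zerom X Y = zerom X Z
}.

Record coproduct (C : category) (X Y : C) := Coproduct {
  coprod_ob :> C;
  inj1 : hom X coprod_ob;
  inj2 : hom Y coprod_ob;
  copair : forall Z, hom X Z -> hom Y Z -> hom coprod_ob Z;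
  copair_inj1 : forall Z (f : hom X Z) (g : hom Y Z), copair f g ∘ inj1 = f;
  copair_inj2 : forall Z (f : hom X Z) (g : hom Y Z), copair f g ∘ inj2 = g;
  copair_unique : forall Z (f : hom X Z) (g : hom Y Z) (u : hom coprod_ob Z),
    u ∘ inj1 = f -> u ∘ inj2 = g -> u = copair f g
}.

Arguments inj1 {C X Y} c.
Arguments inj2 {C X Y} c.
Arguments copair {C X Y} c {Z} f g.

Record kernel (C : category) (P : pointed C) (A B : C) (a : hom A B) :=
  Kernel {
  ker_ob :> C;
  ker_mor : hom ker_ob A;
  ker_comp : a ∘ ker_mor = zerom P ker_ob B;
  ker_lift : forall Z (f : hom Z A), a ∘ f = zerom P Z B -> hom Z ker_ob;
  ker_liftK : forall Z (f : hom Z A) (f0 : a ∘ f = zerom P Z B),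
    ker_mor ∘ ker_lift f0 = f;
  ker_lift_unique : forall Z (f : hom Z A) (f0 : a ∘ f = zerom P Z B)
    (u : hom Z ker_ob), ker_mor ∘ u = f -> u = ker_lift f0
}.

Arguments ker_mor {C P A B a} k.
Arguments ker_comp {C P A B a} k.
Arguments ker_lift {C P A B a} k {Z f} f0.
Arguments ker_liftK {C P A B a} k {Z f} f0.

Definition is_split_epi (C : category) (A B : C) (a : hom A B) : Prop :=
  exists b : hom B A, a ∘ b = idm B.

Definition binary_coproducts (C : category) := forall X Y : C, coproduct X Y.

(* The chosen kernel depends on the epimorphism but not on a splitting of it. *)
Definition split_epi_kernels (C : category) (P : pointed C) :=
  forall (A B : C) (a : hom A B), is_split_epi a -> kernel P a.

Section Points.

Variable C : category.

(* A split epimorphism pt_epi with a specified section pt_sec. *)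
Record point := Point {
  pt_top : C;
  pt_base : C;
  pt_epi : hom pt_top pt_base;
  pt_sec : hom pt_base pt_top;
  pt_split : pt_epi ∘ pt_sec = idm pt_base
}.

Record point_hom (p q : point) := PointHom {
  pth1 : hom (pt_top p) (pt_top q);
  pth0 : hom (pt_base p) (pt_base q);
  pth_epi : pt_epi q ∘ pth1 = pth0 ∘ pt_epi p;
  pth_sec : pth1 ∘ pt_sec p = pt_sec q ∘ pth0
}.

Lemma point_hom_eq (p q : point) (f g : point_hom p q) :
  pth1 f = pth1 g -> pth0 f = pth0 g -> f = g.
Proof.
case: f g => [f1 f0 fe fs] [g1 g0 ge gs] /= E1 E0; subst g1 g0.
by rewrite (proof_irrelevance _ fe ge) (proof_irrelevance _ fs gs).
Qed.

Definition point_id (p : point) : point_hom p p.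
Proof.
by exists (idm _) (idm _); rewrite comp1m compm1.
Defined.

Definition point_comp (p q r : point) (g : point_hom q r) (f : point_hom p q) :
  point_hom p r.
Proof.
exists (pth1 g ∘ pth1 f) (pth0 g ∘ pth0 f).
- by rewrite compA pth_epi -compA pth_epi compA.
- by rewrite -compA pth_sec compA pth_sec compA.
Defined.

Definition Pt : category.
Proof.
refine (@Category point point_hom point_id point_comp _ _ _).
- by move=> p q f; apply: point_hom_eq; rewrite /= comp1m.
- by move=> p q f; apply: point_hom_eq; rewrite /= compm1.
- by move=> p q r s h g f; apply: point_hom_eq; rewrite /= compA.
Defined.

End Points.

Section ReflexiveGraphs.

Variable C : category.

Record reflexive_graph := ReflexiveGraph {
  rg_C1 : C;
  rg_C0 : C;
  rg_d : hom rg_C1 rg_C0;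
  rg_c : hom rg_C1 rg_C0;
  rg_e : hom rg_C0 rg_C1;
  rg_de : rg_d ∘ rg_e = idm rg_C0;
  rg_ce : rg_c ∘ rg_e = idm rg_C0
}.

Record reflexive_graph_hom (X Y : reflexive_graph) := ReflexiveGraphHom {
  rgh1 : hom (rg_C1 X) (rg_C1 Y);
  rgh0 : hom (rg_C0 X) (rg_C0 Y);
  rgh_d : rg_d Y ∘ rgh1 = rgh0 ∘ rg_d X;
  rgh_c : rg_c Y ∘ rgh1 = rgh0 ∘ rg_c X;
  rgh_e : rgh1 ∘ rg_e X = rg_e Y ∘ rgh0
}.

Lemma reflexive_graph_hom_eq (X Y : reflexive_graph)
    (f g : reflexive_graph_hom X Y) :
  rgh1 f = rgh1 g -> rgh0 f = rgh0 g -> f = g.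
Proof.
case: f g => [f1 f0 fd fc fe] [g1 g0 gd gc ge] /= E1 E0; subst g1 g0.
by rewrite (proof_irrelevance _ fd gd) (proof_irrelevance _ fc gc)
           (proof_irrelevance _ fe ge).
Qed.

Definition reflexive_graph_id (X : reflexive_graph) : reflexive_graph_hom X X.
Proof.
by exists (idm _) (idm _); rewrite comp1m compm1.
Defined.

Definition reflexive_graph_comp (X Y Z : reflexive_graph)
    (g : reflexive_graph_hom Y Z) (f : reflexive_graph_hom X Y) :
  reflexive_graph_hom X Z.
Proof.
exists (rgh1 g ∘ rgh1 f) (rgh0 g ∘ rgh0 f).
- by rewrite compA rgh_d -compA rgh_d compA.
- by rewrite compA rgh_c -compA rgh_c compA.
- by rewrite -compA rgh_e compA rgh_e compA.
Defined.

Definition RG : category.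
Proof.
refine (@Category reflexive_graph reflexive_graph_hom
          reflexive_graph_id reflexive_graph_comp _ _ _).
- by move=> X Y f; apply: reflexive_graph_hom_eq; rewrite /= comp1m.
- by move=> X Y f; apply: reflexive_graph_hom_eq; rewrite /= compm1.
- by move=> X Y Z W h g f; apply: reflexive_graph_hom_eq; rewrite /= compA.
Defined.

End ReflexiveGraphs.

Section Precategories.

Variable C : category.

(* The axioms from pc_pi2e2 to pc_e1e say that (pi2, e2) and (d, e), with
   vertical split epimorphisms (pi1, e1) and (c, e), form a split epimorphism
   in the category of split epimorphisms; the square need not be a pullback. *)
Record precategory := Precategory {
  pc_C2 : C;
  pc_C1 : C;
  pc_C0 : C;
  pc_pi1 : hom pc_C2 pc_C1;
  pc_pi2 : hom pc_C2 pc_C1;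
  pc_m : hom pc_C2 pc_C1;
  pc_e1 : hom pc_C1 pc_C2;
  pc_e2 : hom pc_C1 pc_C2;
  pc_d : hom pc_C1 pc_C0;
  pc_c : hom pc_C1 pc_C0;
  pc_e : hom pc_C0 pc_C1;
  pc_pi2e2 : pc_pi2 ∘ pc_e2 = idm pc_C1;
  pc_pi1e1 : pc_pi1 ∘ pc_e1 = idm pc_C1;
  pc_de : pc_d ∘ pc_e = idm pc_C0;
  pc_ce : pc_c ∘ pc_e = idm pc_C0;
  pc_dpi1 : pc_d ∘ pc_pi1 = pc_c ∘ pc_pi2;
  pc_pi1e2 : pc_pi1 ∘ pc_e2 = pc_e ∘ pc_c;
  pc_pi2e1 : pc_pi2 ∘ pc_e1 = pc_e ∘ pc_d;
  pc_e1e : pc_e1 ∘ pc_e = pc_e2 ∘ pc_e;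
  pc_dm : pc_d ∘ pc_m = pc_d ∘ pc_pi2;
  pc_cm : pc_c ∘ pc_m = pc_c ∘ pc_pi1;
  pc_me1 : pc_m ∘ pc_e1 = idm pc_C1;
  pc_me2 : pc_m ∘ pc_e2 = idm pc_C1
}.

Record precategory_hom (X Y : precategory) := PrecategoryHom {
  pch2 : hom (pc_C2 X) (pc_C2 Y);
  pch1 : hom (pc_C1 X) (pc_C1 Y);
  pch0 : hom (pc_C0 X) (pc_C0 Y);
  pch_pi1 : pc_pi1 Y ∘ pch2 = pch1 ∘ pc_pi1 X;
  pch_pi2 : pc_pi2 Y ∘ pch2 = pch1 ∘ pc_pi2 X;
  pch_m : pc_m Y ∘ pch2 = pch1 ∘ pc_m X;
  pch_e1 : pch2 ∘ pc_e1 X = pc_e1 Y ∘ pch1;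
  pch_e2 : pch2 ∘ pc_e2 X = pc_e2 Y ∘ pch1;
  pch_d : pc_d Y ∘ pch1 = pch0 ∘ pc_d X;
  pch_c : pc_c Y ∘ pch1 = pch0 ∘ pc_c X;
  pch_e : pch1 ∘ pc_e X = pc_e Y ∘ pch0
}.

Lemma precategory_hom_eq (X Y : precategory) (f g : precategory_hom X Y) :
  pch2 f = pch2 g -> pch1 f = pch1 g -> pch0 f = pch0 g -> f = g.
Proof.
case: f g => [f2 f1 f0 p1 p2 p3 p4 p5 p6 p7 p8]
             [g2 g1 g0 q1 q2 q3 q4 q5 q6 q7 q8] /= E2 E1 E0; subst g2 g1 g0.
by rewrite (proof_irrelevance _ p1 q1) (proof_irrelevance _ p2 q2)
  (proof_irrelevance _ p3 q3) (proof_irrelevance _ p4 q4)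
  (proof_irrelevance _ p5 q5) (proof_irrelevance _ p6 q6)
  (proof_irrelevance _ p7 q7) (proof_irrelevance _ p8 q8).
Qed.

Definition precategory_id (X : precategory) : precategory_hom X X.
Proof.
by exists (idm _) (idm _) (idm _); rewrite comp1m compm1.
Defined.

Definition precategory_comp (X Y Z : precategory)
    (g : precategory_hom Y Z) (f : precategory_hom X Y) : precategory_hom X Z.
Proof.
exists (pch2 g ∘ pch2 f) (pch1 g ∘ pch1 f) (pch0 g ∘ pch0 f).
- by rewrite compA pch_pi1 -compA pch_pi1 compA.
- by rewrite compA pch_pi2 -compA pch_pi2 compA.
- by rewrite compA pch_m -compA pch_m compA.
- by rewrite -compA pch_e1 compA pch_e1 compA.
- by rewrite -compA pch_e2 compA pch_e2 compA.
- by rewrite compA pch_d -compA pch_d compA.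
- by rewrite compA pch_c -compA pch_c compA.
- by rewrite -compA pch_e compA pch_e compA.
Defined.

Definition PC : category.
Proof.
refine (@Category precategory precategory_hom
          precategory_id precategory_comp _ _ _).
- by move=> X Y f; apply: precategory_hom_eq; rewrite /= comp1m.
- by move=> X Y f; apply: precategory_hom_eq; rewrite /= compm1.
- by move=> X Y Z W h g f; apply: precategory_hom_eq; rewrite /= compA.
Defined.

End Precategories.

Section Arrows.

Variable C : category.

Record arrow := Arrow {
  ar_dom : C;
  ar_cod : C;
  ar_mor : hom ar_dom ar_cod
}.

Record arrow_hom (x y : arrow) := ArrowHom {
  arh1 : hom (ar_dom x) (ar_dom y);
  arh0 : hom (ar_cod x) (ar_cod y);
  arh_comm : ar_mor y ∘ arh1 = arh0 ∘ ar_mor x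
}.

Lemma arrow_hom_eq (x y : arrow) (f g : arrow_hom x y) :
  arh1 f = arh1 g -> arh0 f = arh0 g -> f = g.
Proof.
case: f g => [f1 f0 p] [g1 g0 q] /= E1 E0; subst g1 g0.
by rewrite (proof_irrelevance _ p q).
Qed.

Definition arrow_id (x : arrow) : arrow_hom x x.
Proof.
by exists (idm _) (idm _); rewrite comp1m compm1.
Defined.

Definition arrow_comp (x y z : arrow) (g : arrow_hom y z) (f : arrow_hom x y) :
  arrow_hom x z.
Proof.
exists (arh1 g ∘ arh1 f) (arh0 g ∘ arh0 f).
by rewrite compA arh_comm -compA arh_comm compA.
Defined.

Definition Mor : category.
Proof.
refine (@Category arrow arrow_hom arrow_id arrow_comp _ _ _).
- by move=> x y f; apply: arrow_hom_eq; rewrite /= comp1m.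
- by move=> x y f; apply: arrow_hom_eq; rewrite /= compm1.
- by move=> x y z w h g f; apply: arrow_hom_eq; rewrite /= compA.
Defined.

End Arrows.

Section TwoChains.

Variables (C : category) (P : pointed C).

Record two_chain := TwoChain {
  ch_Z : C;
  ch_X : C;
  ch_B : C;
  ch_t : hom ch_Z ch_X;
  ch_h : hom ch_X ch_B;
  ch_ht : ch_h ∘ ch_t = zerom P ch_Z ch_B
}.

Record two_chain_hom (x y : two_chain) := TwoChainHom {
  chhZ : hom (ch_Z x) (ch_Z y);
  chhX : hom (ch_X x) (ch_X y);
  chhB : hom (ch_B x) (ch_B y);
  chh_t : ch_t y ∘ chhZ = chhX ∘ ch_t x;
  chh_h : ch_h y ∘ chhX = chhB ∘ ch_h x
}.

Lemma two_chain_hom_eq (x y : two_chain) (f g : two_chain_hom x y) :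
  chhZ f = chhZ g -> chhX f = chhX g -> chhB f = chhB g -> f = g.
Proof.
case: f g => [f2 f1 f0 p1 p2] [g2 g1 g0 q1 q2] /= E2 E1 E0; subst g2 g1 g0.
by rewrite (proof_irrelevance _ p1 q1) (proof_irrelevance _ p2 q2).
Qed.

Definition two_chain_id (x : two_chain) : two_chain_hom x x.
Proof.
by exists (idm _) (idm _) (idm _); rewrite comp1m compm1.
Defined.

Definition two_chain_comp (x y z : two_chain)
    (g : two_chain_hom y z) (f : two_chain_hom x y) : two_chain_hom x z.
Proof.
exists (chhZ g ∘ chhZ f) (chhX g ∘ chhX f) (chhB g ∘ chhB f).
- by rewrite compA chh_t -compA chh_t compA.
- by rewrite compA chh_h -compA chh_h compA.
Defined.

Definition TwoChains : category.
Proof.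
refine (@Category two_chain two_chain_hom two_chain_id two_chain_comp _ _ _).
- by move=> x y f; apply: two_chain_hom_eq; rewrite /= comp1m.
- by move=> x y f; apply: two_chain_hom_eq; rewrite /= compm1.
- by move=> x y z w h g f; apply: two_chain_hom_eq; rewrite /= compA.
Defined.

End TwoChains.

Lemma copair_ext (C : category) (X Y : C) (S : coproduct X Y) (Z : C)
    (u v : hom S Z) :
  u ∘ inj1 S = v ∘ inj1 S -> u ∘ inj2 S = v ∘ inj2 S -> u = v.
Proof.
by move=> E1 E2; rewrite (copair_unique E1 E2) -(copair_unique erefl erefl).
Qed.

Lemma ker_ext (C : category) (P : pointed C) (A B : C) (a : hom A B)
    (K : kernel P a) (Z : C) (u v : hom Z K) :
  ker_mor K ∘ u = ker_mor K ∘ v -> u = v.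
Proof.
move=> E.
have v0 : a ∘ (ker_mor K ∘ v) = zerom P Z B.
  by rewrite compA ker_comp zerom_comp.
by rewrite (ker_lift_unique v0 E) -(ker_lift_unique v0 erefl).
Qed.

Section CanonicalAdjunction.

Variables (B : category) (P : pointed B).
Variables (cop : binary_coproducts B) (ker : split_epi_kernels P).

Definition T_ob (X : prod_category B B) : Pt B :=
  @Point B (cop X.1 X.2) X.2
    (copair (cop X.1 X.2) (zerom P X.1 X.2) (idm X.2)) (inj2 (cop X.1 X.2))
    (copair_inj2 _ _ _).

Definition T_hom (X Y : prod_category B B) (f : hom X Y) :
  hom (T_ob X) (T_ob Y).
Proof.
exists (copair (cop X.1 X.2) (inj1 (cop Y.1 Y.2) ∘ f.1)
               (inj2 (cop Y.1 Y.2) ∘ f.2)) f.2.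
- apply: copair_ext => /=.
  + by rewrite -!compA !copair_inj1 compA copair_inj1 zerom_comp comp_zerom.
  + by rewrite -!compA !copair_inj2 compA copair_inj2 comp1m compm1.
- by rewrite /= copair_inj2.
Defined.

Definition T_functor : functor (prod_category B B) (Pt B).
Proof.
refine (@Functor _ _ T_ob T_hom _ _).
- move=> X; apply: point_hom_eq => //=.
  by apply: copair_ext; rewrite ?copair_inj1 ?copair_inj2 comp1m compm1.
- move=> X Y Z g f; apply: point_hom_eq => //=.
  apply: copair_ext.
  + by rewrite -compA !copair_inj1 !compA copair_inj1.
  + by rewrite -compA !copair_inj2 !compA copair_inj2.
Defined.

Definition point_ker (p : Pt B) : kernel P (pt_epi p) :=
  ker (ex_intro _ (pt_sec p) (pt_split p)).

Definition S_ob (p : Pt B) : prod_category B B :=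
  (ker_ob (point_ker p), pt_base p).

Lemma S_hom_subproof (p q : Pt B) (f : hom p q) :
  pt_epi q ∘ (pth1 f ∘ ker_mor (point_ker p)) = zerom P _ _.
Proof. by rewrite compA pth_epi -compA ker_comp comp_zerom. Qed.

Definition S_hom (p q : Pt B) (f : hom p q) : hom (S_ob p) (S_ob q) :=
  (ker_lift (point_ker q) (S_hom_subproof f), pth0 f).

Definition S_functor : functor (Pt B) (prod_category B B).
Proof.
refine (@Functor _ _ S_ob S_hom _ _).
- move=> p; congr pair; apply: ker_ext.
  by rewrite ker_liftK /= comp1m compm1.
- move=> p q r g f; congr pair; apply: ker_ext.
  by rewrite ker_liftK /= compA ker_liftK -!compA ker_liftK.
Defined.

Lemma TS_unit_subproof (X : prod_category B B) :
  pt_epi (T_functor X) ∘ inj1 (cop X.1 X.2) = zerom P X.1 X.2.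
Proof. exact: copair_inj1. Qed.

Definition TS_unit :
  nattrans (id_functor (prod_category B B)) (comp_functor S_functor T_functor).
Proof.
refine (@Nattrans _ _ (id_functor _) (comp_functor S_functor T_functor)
  (fun X : prod_category B B =>
     (ker_lift (point_ker (T_functor X)) (TS_unit_subproof X), idm X.2)) _).
move=> X Y f; congr pair => /=; last by rewrite comp1m compm1.
apply: ker_ext.
by rewrite !compA !ker_liftK /= -compA ker_liftK copair_inj1.
Defined.

Definition TS_counit_component (p : Pt B) : hom (T_functor (S_functor p)) p.
Proof.
refine (@PointHom B (T_functor (S_functor p)) p
  (copair (cop (point_ker p) (pt_base p)) (ker_mor (point_ker p)) (pt_sec p))
  (idm (pt_base p)) _ _).
- apply: copair_ext => /=; rewrite -!compA ?copair_inj1 ?copair_inj2.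
  + by rewrite ker_comp comp1m.
  + by rewrite pt_split comp1m.
- by rewrite /= copair_inj2 compm1.
Defined.

Definition TS_counit :
  nattrans (comp_functor T_functor S_functor) (id_functor (Pt B)).
Proof.
refine (@Nattrans _ _ (comp_functor T_functor S_functor) (id_functor (Pt B))
  TS_counit_component _).
move=> p q f; apply: point_hom_eq => /=; last by rewrite comp1m compm1.
apply: copair_ext; rewrite -!compA ?copair_inj1 ?copair_inj2 compA.
- by rewrite copair_inj1 ker_liftK.
- by rewrite copair_inj2 pth_sec.
Defined.

Definition TS_adjunction : adjunction T_functor S_functor.
Proof.
refine (@Adjunction _ _ T_functor S_functor TS_unit TS_counit _ _).
- move=> X; apply: point_hom_eq => /=; last by rewrite comp1m.
  apply: copair_ext; rewrite -compA ?copair_inj1 ?copair_inj2 compA.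
  + by rewrite copair_inj1 ker_liftK comp1m.
  + by rewrite copair_inj2 compm1 comp1m.
- move=> p; congr pair => /=; last by rewrite comp1m.
  apply: ker_ext.
  by rewrite compA ker_liftK /= -compA ker_liftK copair_inj1 compm1.
Defined.

End CanonicalAdjunction.

(* Main.v *)
(* Invertibility of the unit says that the first injection is a kernel of
   [0 1] : X ⊔ B -> B; invertibility of the counit says that every split
   epimorphism is isomorphic to such a [0 1] with section ι2.

   A reflexive graph is therefore, up to isomorphism, X ⊔ B with d = [0 1],
   e = ι2 and c = [h 1] for an arbitrary h : X -> B.  In a precategory, the
   split epimorphism (π2, e2) gives C2 = Y ⊔ C1; then π1 and e1 restrict to a
   split epimorphism between the kernels Y of π2 and X of d, so Y = Z ⊔ X.
   The unit laws determine m on all summands of (Z ⊔ X) ⊔ (X ⊔ B) except Z,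
   where the condition dm = dπ2 makes it a morphism t : Z -> X and the
   condition cm = cπ1 becomes ht = 0.

   Both constructions, from (X, B, h) and from (Z, X, B, t, h), are fully
   faithful because every component of a morphism is determined on the
   injections and restricts to the kernels. *)
From Stdlib Require Import ssreflect ssrfun ssrbool IndefiniteDescription.
Require Import Defs.

Set Implicit Arguments.
Unset Strict Implicit.
Unset Printing Implicit Defensive.

Local Open Scope cat_scope.

(** * Inverses, and equivalences from fully faithful, essentially surjective functors *)

Lemma comp_reassoc (C : category) (X Y Z : C) (f : hom Y Z) (g : hom X Y)
    (h : hom X Z) (E : f ∘ g = h) (W : C) (x : hom W X) :
  f ∘ (g ∘ x) = h ∘ x.
Proof. by rewrite compA E. Qed.

Lemma is_iso_id (C : category) (X : C) : is_iso (idm X).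
Proof. by exists (idm X); rewrite comp1m. Qed.

Lemma is_iso_comp (C : category) (X Y Z : C) (g : hom Y Z) (f : hom X Y) :
  is_iso g -> is_iso f -> is_iso (g ∘ f).
Proof.
move=> [g' [g'g gg']] [f' [f'f ff']]; exists (f' ∘ g').
by rewrite -!compA (comp_reassoc g'g) (comp_reassoc ff') !comp1m.
Qed.

(** Applied to each structure map, this makes the componentwise inverse of a morphism of diagrams a
    morphism again. *)
Lemma iso_conjugate (C : category) (X X' Y Y' : C) (i : hom X X')
    (i' : hom X' X) (j : hom Y Y') (j' : hom Y' Y) (f : hom X Y)
    (g : hom X' Y') :
  i ∘ i' = idm X' -> j' ∘ j = idm Y -> g ∘ i = j ∘ f -> f ∘ i' = j' ∘ g.
Proof.
move=> ii' j'j E.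
by rewrite -(compm1 (j' ∘ g)) -ii' -compA (comp_reassoc E) -!compA
  (comp_reassoc j'j) comp1m.
Qed.

(** An equivalence requires actual functors, so preimages and inverses are chosen by indefinite
    description; faithfulness makes the choices functorial. *)
Lemma fully_faithful_essentially_surjective (C D : category) (G : functor D C) :
  (forall X Y (f g : hom X Y), fmap G f = fmap G g -> f = g) ->
  (forall X Y (u : hom (G X) (G Y)), exists f : hom X Y, fmap G f = u) ->
  (forall Y : C, exists (X : D) (i : hom (G X) Y), is_iso i) ->
  equivalent_categories C D.
Proof.
move=> faithful full surj.
have preim X Y (u : hom (G X) (G Y)) : {f : hom X Y | fmap G f = u}.
  exact: constructive_indefinite_description.
have cover Y : {X : D & {i : hom (G X) Y & {j : hom Y (G X) |
    j ∘ i = idm (G X) /\ i ∘ j = idm Y}}}.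
  have [X HX] := constructive_indefinite_description _ (surj Y).
  have [i Hi] := constructive_indefinite_description _ HX.
  by exists X, i; apply: constructive_indefinite_description.
pose F0 Y := projT1 (cover Y).
pose i Y : hom (G (F0 Y)) Y := projT1 (projT2 (cover Y)).
pose j Y : hom Y (G (F0 Y)) := proj1_sig (projT2 (projT2 (cover Y))).
have ji Y : j Y ∘ i Y = idm _ by case: (proj2_sig (projT2 (projT2 (cover Y)))).
have ij Y : i Y ∘ j Y = idm _ by case: (proj2_sig (projT2 (projT2 (cover Y)))).
pose p X Y (u : hom (G X) (G Y)) : hom X Y := proj1_sig (preim X Y u).
have pK X Y (u : hom (G X) (G Y)) : fmap G (p X Y u) = u.
  exact: proj2_sig (preim X Y u).
have F1 X : p _ _ (j X ∘ (idm X ∘ i X)) = idm (F0 X).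
  by apply: faithful; rewrite pK comp1m ji fmap1.
have FM X Y Z (g : hom Y Z) (f : hom X Y) :
    p _ _ (j Z ∘ ((g ∘ f) ∘ i X)) =
    p _ _ (j Z ∘ (g ∘ i Y)) ∘ p _ _ (j Y ∘ (f ∘ i X)).
  apply: faithful; rewrite fmapM !pK -!compA.
  by rewrite (comp_reassoc (ij _)) comp1m.
pose F := @Functor C D F0 (fun X Y f => p _ _ (j Y ∘ (f ∘ i X))) F1 FM.
exists F, G; split.
- have nat X Y (f : hom X Y) : i Y ∘ fmap G (p _ _ (j Y ∘ (f ∘ i X))) = f ∘ i X.
    by rewrite pK (comp_reassoc (ij _)) comp1m.
  exists (@Nattrans _ _ (comp_functor G F) (id_functor C) i nat) => X.
  by exists (j X); split; [exact: ji | exact: ij].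
(* The second natural isomorphism consists of the preimages under [G] of the [i (G X)]. *)
- have nat X Y (f : hom X Y) : 
      p _ _ (i (G Y)) ∘ p _ _ (j (G Y) ∘ (fmap G f ∘ i (G X))) =
      f ∘ p _ _ (i (G X)).
    apply: faithful; rewrite !fmapM !pK.
    by rewrite (comp_reassoc (ij _)) comp1m.
  exists (@Nattrans _ _ (comp_functor F G) (id_functor D)
    (fun X => p _ _ (i (G X))) nat) => X.
  exists (p _ _ (j (G X))).
  by split; apply: faithful; rewrite fmapM !pK fmap1 /= ?ij ?ji.
Qed.

(** * Calculations with coproducts and zero morphisms *)

Lemma copair_inj1A (C : category) (X Y : C) (S : coproduct X Y) (W Z : C)
    (f : hom X Z) (g : hom Y Z) (x : hom W X) :
  copair S f g ∘ (inj1 S ∘ x) = f ∘ x.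
Proof. exact/comp_reassoc/copair_inj1. Qed.

Lemma copair_inj2A (C : category) (X Y : C) (S : coproduct X Y) (W Z : C)
    (f : hom X Z) (g : hom Y Z) (y : hom W Y) :
  copair S f g ∘ (inj2 S ∘ y) = g ∘ y.
Proof. exact/comp_reassoc/copair_inj2. Qed.

Ltac cat_simp := repeat progress rewrite -?compA
  ?(comp1m, compm1, zerom_comp, comp_zerom, copair_inj1, copair_inj2,
    copair_inj1A, copair_inj2A) /=.

Lemma is_iso_coprod (C : category) (X Y X' Y' : C) (S : coproduct X Y)
    (S' : coproduct X' Y') (f : hom X X') (g : hom Y Y') :
  is_iso f -> is_iso g -> is_iso (copair S (inj1 S' ∘ f) (inj2 S' ∘ g)).
Proof.
move=> [f' [f'f ff']] [g' [g'g gg']].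
exists (copair S' (inj1 S ∘ f') (inj2 S ∘ g')).
by split; apply: copair_ext; cat_simp; rewrite ?f'f ?ff' ?g'g ?gg' compm1.
Qed.

(** The zero morphism provides a retraction [[1 0]] of the injection. *)
Lemma inj1_mono (B : category) (P : pointed B) (X Y Z : B) (S : coproduct X Y)
    (f g : hom Z X) :
  inj1 S ∘ f = inj1 S ∘ g -> f = g.
Proof.
move=> /(congr1 (fun u => copair S (idm X) (zerom P Y X) ∘ u)).
by cat_simp.
Qed.

Lemma reflexive_graph_iso (C : category) (X Y : RG C) (f : hom X Y) :
  is_iso (rgh1 f) -> is_iso (rgh0 f) -> is_iso f.
Proof.
move=> [g1 [gf1 fg1]] [g0 [gf0 fg0]].
have gd := iso_conjugate fg1 gf0 (rgh_d f).
have gc := iso_conjugate fg1 gf0 (rgh_c f).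
have ge := iso_conjugate fg0 gf1 (esym (rgh_e f)).
by exists (ReflexiveGraphHom gd gc (esym ge)); split;
  apply: reflexive_graph_hom_eq.
Qed.

Lemma precategory_iso (C : category) (X Y : PC C) (f : hom X Y) :
  is_iso (pch2 f) -> is_iso (pch1 f) -> is_iso (pch0 f) -> is_iso f.
Proof.
move=> [g2 [gf2 fg2]] [g1 [gf1 fg1]] [g0 [gf0 fg0]].
have gpi1 := iso_conjugate fg2 gf1 (pch_pi1 f).
have gpi2 := iso_conjugate fg2 gf1 (pch_pi2 f).
have gm := iso_conjugate fg2 gf1 (pch_m f).
have ge1 := iso_conjugate fg1 gf2 (esym (pch_e1 f)).
have ge2 := iso_conjugate fg1 gf2 (esym (pch_e2 f)).
have gd := iso_conjugate fg1 gf0 (pch_d f).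
have gc := iso_conjugate fg1 gf0 (pch_c f).
have ge := iso_conjugate fg0 gf1 (esym (pch_e f)).
by exists (PrecategoryHom gpi1 gpi2 gm (esym ge1) (esym ge2)
  gd gc (esym ge)); split; apply: precategory_hom_eq.
Qed.

(** * Graphs from arrows and precategories from chains *)

Section Equivalences.

Variables (B : category) (P : pointed B) (cop : binary_coproducts B).

Definition graph_of_arrow (x : Mor B) : RG B :=
  let S := cop (ar_dom x) (ar_cod x) in
  @ReflexiveGraph B S (ar_cod x) (copair S (zerom P _ _) (idm _))
    (copair S (ar_mor x) (idm _)) (inj2 S)
    (copair_inj2 _ _ _) (copair_inj2 _ _ _).

Definition graph_of_arrow_hom (x y : Mor B) (f : hom x y) :
  hom (graph_of_arrow x) (graph_of_arrow y).
Proof.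
exists (copair (cop (ar_dom x) (ar_cod x))
  (inj1 (cop (ar_dom y) (ar_cod y)) ∘ arh1 f)
  (inj2 (cop (ar_dom y) (ar_cod y)) ∘ arh0 f)) (arh0 f).
- by apply: copair_ext => /=; cat_simp.
- by apply: copair_ext => /=; cat_simp; rewrite ?arh_comm.
- by cat_simp.
Defined.

Definition graph_functor : functor (Mor B) (RG B).
Proof.
refine (@Functor _ _ graph_of_arrow graph_of_arrow_hom _ _).
- by move=> x; apply: reflexive_graph_hom_eq => //=; apply: copair_ext;
    cat_simp.
- by move=> x y z g f; apply: reflexive_graph_hom_eq => //=;
    apply: copair_ext; cat_simp.
Defined.

(** On the summand [C1], [pi1] and [m] are forced by [pc_pi1e2] and [pc_me2]. On [Y], [pi1] is
    [[0 1]] followed by the first injection, which is the split epimorphism between the kernels of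
    [pi2] and [d]; [e1] restricts to its section. *)
Definition precategory_of_chain (x : TwoChains P) : PC B.
Proof.
pose C1 := cop (ch_X x) (ch_B x); pose Y := cop (ch_Z x) (ch_X x).
pose C2 := cop Y C1.
pose c := copair C1 (ch_h x) (idm (ch_B x)).
unshelve refine (@Precategory B C2 C1 (ch_B x)
  (copair C2 (copair Y (zerom P _ _) (inj1 C1)) (inj2 C1 ∘ c))
  (copair C2 (zerom P _ _) (idm _))
  (copair C2 (copair Y (inj1 C1 ∘ ch_t x) (inj1 C1)) (idm _))
  (copair C1 (inj1 C2 ∘ inj2 Y) (inj2 C2 ∘ inj2 C1)) (inj2 C2)
  (copair C1 (zerom P _ _) (idm _)) c (inj2 C1)
  _ _ _ _ _ _ _ _ _ _ _ _); rewrite /c.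
(* The equation [ch_ht] enters in [pc_cm], on the summand [ch_Z x]. *)
all: by cat_simp; do ?apply: copair_ext; cat_simp; rewrite ?ch_ht.
Defined.

Definition precategory_of_chain_hom (x y : TwoChains P) (f : hom x y) :
  hom (precategory_of_chain x) (precategory_of_chain y).
Proof.
pose C1 := cop (ch_X x) (ch_B x); pose Y := cop (ch_Z x) (ch_X x).
pose C1' := cop (ch_X y) (ch_B y); pose Y' := cop (ch_Z y) (ch_X y).
pose f1 := copair C1 (inj1 C1' ∘ chhX f) (inj2 C1' ∘ chhB f).
pose fY := copair Y (inj1 Y' ∘ chhZ f) (inj2 Y' ∘ chhX f).
unshelve refine (@PrecategoryHom B (precategory_of_chain x)
  (precategory_of_chain y)
  (copair (cop Y C1) (inj1 (cop Y' C1') ∘ fY) (inj2 (cop Y' C1') ∘ f1))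
  f1 (chhB f) _ _ _ _ _ _ _ _); rewrite /f1 /fY /=.
all: by cat_simp; do ?apply: copair_ext; cat_simp; rewrite ?chh_t ?chh_h.
Defined.

Definition precategory_functor : functor (TwoChains P) (PC B).
Proof.
refine (@Functor _ _ precategory_of_chain precategory_of_chain_hom _ _).
- by move=> x; apply: precategory_hom_eq => //=; do ?apply: copair_ext;
    cat_simp.
- by move=> x y z g f; apply: precategory_hom_eq => //=;
    do ?apply: copair_ext; cat_simp.
Defined.

(** Only the existence half of the kernel property is assumed; uniqueness is [inj1_mono]. *)
Hypothesis inj1_kernel : forall (X Y Z : B) (f : hom Z (cop X Y)),
  copair (cop X Y) (zerom P X Y) (idm Y) ∘ f = zerom P Z Y ->
  exists g : hom Z X, inj1 (cop X Y) ∘ g = f.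

Hypothesis split_epi_coproduct : forall (A Y : B) (a : hom A Y) (b : hom Y A),
  a ∘ b = idm Y ->
  exists (X : B) (k : hom X A),
    a ∘ k = zerom P X Y /\ is_iso (copair (cop X Y) k b).

(** The isomorphism [[k b]] carries [inj1] to [k] and turns [a] into [[0 1]], so the kernel property
    of [inj1] transfers to [k]. *)
Lemma split_epi_decomposition (A Y : B) (a : hom A Y) (b : hom Y A) :
  a ∘ b = idm Y ->
  exists (X : B) (k : hom X A),
    [/\ a ∘ k = zerom P X Y,
        is_iso (copair (cop X Y) k b),
        forall (Z : B) (f : hom Z A), a ∘ f = zerom P Z Y ->
          exists g : hom Z X, k ∘ g = f
      & forall (Z : B) (u v : hom Z X), k ∘ u = k ∘ v -> u = v].
Proof.
move=> ab; have [X [k [ak [j [ji ij]]]]] := split_epi_coproduct ab.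
exists X, k; split => //; first by exists j.
- move=> Z f af.
  have ai : a ∘ copair (cop X Y) k b =
      copair (cop X Y) (zerom P X Y) (idm Y) by apply: copair_ext; cat_simp.
  have [|g Eg] := @inj1_kernel X Y Z (j ∘ f).
    by rewrite -ai -compA (comp_reassoc ij) comp1m.
  by exists g; rewrite -[RHS]comp1m -ij -compA -Eg; cat_simp.
- move=> Z u v E; apply: (@inj1_mono _ P _ _ _ (cop X Y)).
  rewrite -[LHS]comp1m -[RHS]comp1m -ji -!compA; congr (_ ∘ _).
  by cat_simp.
Qed.

Lemma RG_equivalent_Mor : equivalent_categories (RG B) (Mor B).
Proof.
apply: (@fully_faithful_essentially_surjective _ _ graph_functor).
- move=> x y f g E; apply: arrow_hom_eq; last exact: (congr1 (@rgh0 _ _ _) E).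
  move: (congr1 (fun u => u ∘ inj1 _) (congr1 (@rgh1 _ _ _) E)) => /=.
  by rewrite !copair_inj1 => /(inj1_mono P).
- move=> x y u.
  (* Since [u] commutes with [d], it restricts to the kernels of the two [d]. *)
  have [|f1 Ef1] := @inj1_kernel _ _ _ (rgh1 u ∘ inj1 (cop _ _)).
    by rewrite (comp_reassoc (rgh_d u)); cat_simp.
  have fh : ar_mor y ∘ f1 = rgh0 u ∘ ar_mor x.
    move: (congr1 (fun v => v ∘ inj1 _) (rgh_c u)) => /=.
    by rewrite -!compA -Ef1; cat_simp.
  exists (ArrowHom fh); apply: reflexive_graph_hom_eq => //=.
  by apply: copair_ext; cat_simp; rewrite //; exact: esym (rgh_e u).
- move=> Y; have [X [k [dk iso_ke _ _]]] := split_epi_decomposition (rg_de Y).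
  (* The arrow is the codomain map restricted to the kernel of [d]; the comparison is [[k e]]. *)
  pose x := Arrow (rg_c Y ∘ k); exists x.
  unshelve eexists (@ReflexiveGraphHom _ (graph_of_arrow x) Y
    (copair (cop X (rg_C0 Y)) k (rg_e Y)) (idm _) _ _ _).
  + by apply: copair_ext; cat_simp; rewrite ?dk ?rg_de.
  + by apply: copair_ext; cat_simp; rewrite ?rg_ce.
  + by cat_simp.
  + by apply: reflexive_graph_iso => //; apply: is_iso_id.
Qed.

Lemma PC_equivalent_TwoChains : equivalent_categories (PC B) (TwoChains P).
Proof.
apply: (@fully_faithful_essentially_surjective _ _ precategory_functor).
- move=> x y f g E.
  have EX : chhX f = chhX g.
    move: (congr1 (fun u => u ∘ inj1 _) (congr1 (@pch1 _ _ _) E)) => /=.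
    by rewrite !copair_inj1 => /(inj1_mono P).
  apply: two_chain_hom_eq => //; last exact: (congr1 (@pch0 _ _ _) E).
  move: (congr1 (fun u => u ∘ (inj1 _ ∘ inj1 _)) (congr1 (@pch2 _ _ _) E)).
  by cat_simp; move=> /(inj1_mono P) /(inj1_mono P).
- move=> x y u.
  have [|fX EfX] := @inj1_kernel _ _ _ (pch1 u ∘ inj1 (cop _ _)).
    by rewrite (comp_reassoc (pch_d u)); cat_simp.
  have [|w Ew] := @inj1_kernel _ _ _
      (pch2 u ∘ (inj1 (cop _ _) ∘ inj1 (cop _ _))).
    by rewrite (comp_reassoc (pch_pi2 u)); cat_simp.
  (* Compatibility with [pi1] gives [[0 1] ∘ w = 0], so [w] factors through [ch_Z y]. *)
  have [|fZ EfZ] := @inj1_kernel _ _ _ w.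
    apply: (@inj1_mono _ P _ _ _ (cop (ch_X y) (ch_B y))).
    have /= := congr1 (fun v => v ∘ (inj1 _ ∘ inj1 _)) (pch_pi1 u).
    rewrite -!compA -Ew; cat_simp; move=> <-.
    rewrite compA; congr (_ ∘ _).
    by apply: copair_ext; cat_simp.
  have ft : ch_t y ∘ fZ = fX ∘ ch_t x.
    apply: (@inj1_mono _ P _ _ _ (cop (ch_X y) (ch_B y))).
    have /= := congr1 (fun v => v ∘ (inj1 _ ∘ inj1 _)) (pch_m u).
    rewrite -!compA -Ew -EfZ; cat_simp; move=> ->.
    by rewrite (comp_reassoc EfX) compA.
  have fh : ch_h y ∘ fX = pch0 u ∘ ch_h x.
    move: (congr1 (fun v => v ∘ inj1 _) (pch_c u)) => /=.
    by rewrite -!compA -EfX; cat_simp.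
  have /= Ee1 := congr1 (fun v => v ∘ inj1 _) (pch_e1 u).
  have /= Ee2 := pch_e2 u.
  have /= Ee := pch_e u.
  have Ef1 : pch1 u = copair (cop (ch_X x) (ch_B x))
      (inj1 (cop (ch_X y) (ch_B y)) ∘ fX) (inj2 (cop _ _) ∘ pch0 u).
    by apply: copair_ext; cat_simp.
  exists (TwoChainHom ft fh); apply: precategory_hom_eq => //=.
  (* On the summand Z the value is [fZ] by construction; on the X next to it [e1] decides, and on
     both parts of [C1] [e2] does. *)
  do ?apply: copair_ext; cat_simp.
  + by rewrite EfZ.
  + by move: Ee1; rewrite /= -!compA -EfX; cat_simp.
  + by rewrite EfX (comp_reassoc Ee2) -compA.
  + by rewrite -Ee (comp_reassoc Ee2) -compA.
- move=> Y.
  have [X [k [dk iso_ke k_factor k_mono]]] := split_epi_decomposition (pc_de Y).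
  have [K [l [pi2l iso_le l_factor _]]] := split_epi_decomposition (pc_pi2e2 Y).
  (* The maps [a] and [b] are the restrictions of [pi1] and [e1] to the kernels [K] of [pi2] and [X]
     of [d]. *)
  have [|a /esym pi1l] := k_factor _ (pc_pi1 Y ∘ l).
    by rewrite (comp_reassoc (pc_dpi1 Y)) -compA pi2l comp_zerom.
  have [|b lb] := l_factor _ (pc_e1 Y ∘ k).
    by rewrite (comp_reassoc (pc_pi2e1 Y)) -compA dk comp_zerom.
  have ab : a ∘ b = idm X.
    apply: k_mono.
    by rewrite compA -pi1l -compA lb (comp_reassoc (pc_pi1e1 Y)); cat_simp.
  have [Z [z [az iso_zb _ _]]] := split_epi_decomposition ab.
  (* The map [t] is [m] restricted to the kernel [Z] of [a]; it lands in [X] because [d m = d pi2]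
     vanishes there. *)
  have [|t kt] := k_factor _ (pc_m Y ∘ (l ∘ z)).
    by rewrite (comp_reassoc (pc_dm Y)) -compA (comp_reassoc pi2l); cat_simp.
  (* Here [c m = c pi1], and [pi1] vanishes on [Z] because [a ∘ z = 0]. *)
  have ht : (pc_c Y ∘ k) ∘ t = zerom P _ _.
    rewrite -compA kt (comp_reassoc (pc_cm Y)) -compA.
    by rewrite (comp_reassoc pi1l) -compA az; cat_simp.
  pose x := TwoChain ht; exists x.
  pose f1 := copair (cop X (pc_C0 Y)) k (pc_e Y).
  pose f2 := copair (cop (cop Z X) (cop X (pc_C0 Y)))
    (l ∘ copair (cop Z X) z b) (pc_e2 Y ∘ f1).
  (* Two decompositions are composed: [[z b]] and [[k e]] summandwise, then [[l e2]]. *)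
  have iso_f2 : is_iso f2.
    have -> : f2 = copair (cop K (pc_C1 Y)) l (pc_e2 Y) ∘
        copair (cop (cop Z X) (cop X (pc_C0 Y)))
          (inj1 (cop K (pc_C1 Y)) ∘ copair (cop Z X) z b)
          (inj2 (cop K (pc_C1 Y)) ∘ f1) by apply: copair_ext; cat_simp.
    by apply: is_iso_comp => //; apply: is_iso_coprod.
  unshelve eexists (@PrecategoryHom _ (precategory_of_chain x) Y f2 f1 (idm _)
    _ _ _ _ _ _ _ _) => /=; rewrite /f1 /f2.
  + do ?apply: copair_ext; cat_simp.
    * by rewrite (comp_reassoc pi1l) -compA az; cat_simp.
    * by rewrite (comp_reassoc pi1l) -compA ab; cat_simp.
    * by rewrite (comp_reassoc (pc_pi1e2 Y)) -compA.
    * by rewrite (comp_reassoc (pc_pi1e2 Y)) -compA pc_ce; cat_simp.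
  + by do ?apply: copair_ext; cat_simp;
      rewrite ?(comp_reassoc pi2l) ?(comp_reassoc (pc_pi2e2 Y)); cat_simp.
  + do ?apply: copair_ext; cat_simp => //.
    * by rewrite lb (comp_reassoc (pc_me1 Y)) comp1m.
    * by rewrite (comp_reassoc (pc_me2 Y)) comp1m.
    * by rewrite (comp_reassoc (pc_me2 Y)) comp1m.
  + by apply: copair_ext; cat_simp; rewrite ?pc_e1e.
  + by cat_simp.
  + by apply: copair_ext; cat_simp; rewrite ?dk ?pc_de.
  + by apply: copair_ext; cat_simp; rewrite ?pc_ce.
  + by cat_simp.
  + by apply: precategory_iso => //=; apply: is_iso_id.
Qed.

End Equivalences.

(** * Unpacking the invertible unit and counit *)

Section AdjointEquivalence.

Variables (B : category) (P : pointed B) (cop : binary_coproducts B).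
Variable ker : split_epi_kernels P.

(** The unit compares [X] with the chosen kernel of [[0 1]]; composing a lift into that kernel with
    the inverse [r] gives the factorization. *)
Lemma inj1_kernel_of_unit_iso :
  is_natiso (TS_unit cop ker) ->
  forall (X Y Z : B) (f : hom Z (cop X Y)),
    copair (cop X Y) (zerom P X Y) (idm Y) ∘ f = zerom P Z Y ->
    exists g : hom Z X, inj1 (cop X Y) ∘ g = f.
Proof.
move=> unit_iso X Y Z f f0.
have [[r s] [_ /(congr1 fst) /= ur]] := unit_iso (X, Y).
pose K := point_ker ker (T_functor P cop (X, Y)).
exists (r ∘ ker_lift K f0).
rewrite -(ker_liftK K (TS_unit_subproof P cop (X, Y))) -compA.
by rewrite (comp_reassoc ur) comp1m ker_liftK.
Qed.

(** With [k] the chosen kernel of [a], the top component of the counit at the point [p] is exactly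
    [[k b]]. *)
Lemma split_epi_coproduct_of_counit_iso :
  is_natiso (TS_counit cop ker) ->
  forall (A Y : B) (a : hom A Y) (b : hom Y A), a ∘ b = idm Y ->
  exists (X : B) (k : hom X A),
    a ∘ k = zerom P X Y /\ is_iso (copair (cop X Y) k b).
Proof.
move=> counit_iso A Y a b ab; pose p := Point ab.
exists (point_ker ker p), (ker_mor (point_ker ker p)); split.
  exact: ker_comp (point_ker ker p).
have [g [gc cg]] := counit_iso p.
by exists (pth1 g); split; [move: (congr1 (@pth1 _ _ _) gc)
  | move: (congr1 (@pth1 _ _ _) cg)].
Qed.

End AdjointEquivalence.

Theorem theorem6 (B : category) (P : pointed B) (cop : binary_coproducts B)
    (ker : split_epi_kernels P) :
  adjunction_is_equivalence (TS_adjunction cop ker) ->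
  equivalent_categories (RG B) (Mor B) /\
  equivalent_categories (PC B) (TwoChains P).
Proof.
move=> [/inj1_kernel_of_unit_iso inj1_kernel].
move=> /split_epi_coproduct_of_counit_iso split_epi_coproduct.
by split; [apply: RG_equivalent_Mor | apply: PC_equivalent_TwoChains];
  eassumption.
Qed.
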